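(* Let $\alpha_0+\alpha_1+2\alpha_2+2\alpha_3+2\alpha_4+2\alpha_5=1$ and consider the system \begin{align*} \frac{dx}{dt}&=-\frac{2x^3y-2x^2y+(\alpha_1+2\alpha_2)x^2+(t-1+2\alpha_3+2\alpha_4+2\alpha_5)x-t}{t}-\frac{2(x-1)z(zw+\alpha_4)}{t},\\ \frac{dy}{dt}&=\frac{3x^2y^2-2xy^2+2(\alpha_1+2\alpha_2)xy+(t-1+2\alpha_3+2\alpha_4+2\alpha_5)y+\alpha_2(\alpha_1+\alpha_2)}{t}+\frac{2yz(zw+\alpha_4)}{t},\\ \frac{dz}{dt}&=-\frac{2z^3w-2z^2w+(\alpha_1+2\alpha_2+\alpha_3+2\alpha_4)z^2+(t-1+2\alpha_5)z-t}{t}-\frac{2(x-1)yz^2}{t},\\ \frac{dw}{dt}&=\frac{3z^2w^2-2zw^2+2(\alpha_1+2\alpha_2+\alpha_3+2\alpha_4)zw+(t-1+2\alpha_5)w}{t}\\ &\quad+\frac{\alpha_4(\alpha_1+2\alpha_2+\alpha_3+\alpha_4)+2(x-1)y(2zw+\alpha_4)}{t}. \end{align*} Make the change of parameters and variables $$\beta_0=\alpha_4+2\alpha_5,\quad\beta_1=\alpha_4,\quad\beta_2=\alpha_3,\quad\beta_3=\alpha_2,\quad\beta_4=\alpha_0,\quad\beta_5=\alpha_1,$$ $$X=\frac1z,\quad Y=-z(zw+\alpha_4),\quad Z=\frac1x,\quad W=-x(xy+\alpha_2),\quad T=-t.$$ Then the system can be written in the new variables $T,X,Y,Z,W$ and parameters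 $\beta_0,\dots,\beta_5$ as a Hamiltonian system, and this new system coincides with the system of type $D_5^{(1)}$: \begin{align*} \frac{dX}{dT}&=\frac{2X^2Y}{T}+X^2-\frac{2XY}{T}-\Big(1+\frac{2\beta_2+2\beta_3+\beta_5+\beta_4}{T}\Big)X+\frac{\beta_2+\beta_5}{T}+\frac{2Z((Z-1)W+\beta_3)}{T},\\ \frac{dY}{dT}&=-\frac{2XY^2}{T}+\frac{Y^2}{T}-2XY+\Big(1+\frac{2\beta_2+2\beta_3+\beta_5+\beta_4}{T}\Big)Y-\beta_1,\\ \frac{dZ}{dT}&=\frac{2Z^2W}{T}+Z^2-\frac{2ZW}{T}-\Big(1+\frac{\beta_5+\beta_4}{T}\Big)Z+\frac{\beta_5}{T}+\frac{2YZ(Z-1)}{T},\\ \frac{dW}{dT}&=-\frac{2ZW^2}{T}+\frac{W^2}{T}-2ZW+\Big(1+\frac{\beta_5+\beta_4}{T}\Big)W-\beta_3-\frac{2Y(-W+2ZW+\beta_3)}{T}, \end{align*} with the Hamiltonian $$H=H_{A_3^{(1)}}(X,Y,T;\beta_2+\beta_5,\beta_1,\beta_2+2\beta_3+\beta_4)+H_{A_3^{(1)}}(Z,W,T;\beta_5,\beta_3,\beta_4)+\frac{2YZ\{(Z-1)W+\beta_3\}}{T}.$$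
   Context: Here $$H_{A_3^{(1)}}(q,p,T;b_1,b_2,b_3)=\frac{p(p+T)q(q-1)+b_2qT-b_3qp-b_1p(q-1)}{T}.$$ A Hamiltonian system with Hamiltonian $H(X,Y,Z,W,T)$ means $dX/dT=\partial H/\partial Y$, $dY/dT=-\partial H/\partial X$, $dZ/dT=\partial H/\partial W$, $dW/dT=-\partial H/\partial Z$. *)

(* Defs.v *)
From HB Require Import structures.
From mathcomp Require Import all_boot all_order all_algebra.
From mathcomp Require Import all_classical all_reals all_analysis.
Import Order.TTheory GRing.Theory Num.Theory.
Import numFieldNormedType.Exports.

Set Implicit Arguments.
Unset Strict Implicit.
Unset Printing Implicit Defensive.

Local Open Scope classical_set_scope.
Local Open Scope ring_scope.

(* All systems are stated over an arbitrary K : numFieldType, with the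
   derivative in K itself: K = R[i] gives holomorphic solutions in a complex
   time variable, K = R gives real solutions. A system is the predicate on a
   time set D and four functions of being a solution at every point of D; only
   the restrictions of the functions to a neighborhood of D matter. *)

Section Systems.
Variable K : numFieldType.
Implicit Types (D : set K) (x y z w X Y Z W : K -> K).

(* The parameters alpha_0 and beta_0 do not occur in the right-hand sides; they
   enter only through the normalization of the parameters. *)
Definition xyzw_system (a1 a2 a3 a4 a5 : K) D x y z w : Prop :=
  forall t, D t ->
  [/\ is_derive t 1 x
        (- ((2 * x t ^+ 3 * y t - 2 * x t ^+ 2 * y t
             + (a1 + 2 * a2) * x t ^+ 2
             + (t - 1 + 2 * a3 + 2 * a4 + 2 * a5) * x t - t) / t)
         - (2 * (x t - 1) * z t * (z t * w t + a4)) / t),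
      is_derive t 1 y
        ((3 * x t ^+ 2 * y t ^+ 2 - 2 * x t * y t ^+ 2
          + 2 * (a1 + 2 * a2) * x t * y t
          + (t - 1 + 2 * a3 + 2 * a4 + 2 * a5) * y t
          + a2 * (a1 + a2)) / t
         + (2 * y t * z t * (z t * w t + a4)) / t),
      is_derive t 1 z
        (- ((2 * z t ^+ 3 * w t - 2 * z t ^+ 2 * w t
             + (a1 + 2 * a2 + a3 + 2 * a4) * z t ^+ 2
             + (t - 1 + 2 * a5) * z t - t) / t)
         - (2 * (x t - 1) * y t * z t ^+ 2) / t)
    & is_derive t 1 w
        ((3 * z t ^+ 2 * w t ^+ 2 - 2 * z t * w t ^+ 2
          + 2 * (a1 + 2 * a2 + a3 + 2 * a4) * z t * w t
          + (t - 1 + 2 * a5) * w t) / t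
         + (a4 * (a1 + 2 * a2 + a3 + a4)
            + 2 * (x t - 1) * y t * (2 * z t * w t + a4)) / t)].

Definition D5_system (b1 b2 b3 b4 b5 : K) D X Y Z W : Prop :=
  forall T, D T ->
  [/\ is_derive T 1 X
        ((2 * X T ^+ 2 * Y T) / T + X T ^+ 2 - (2 * X T * Y T) / T
         - (1 + (2 * b2 + 2 * b3 + b5 + b4) / T) * X T + (b2 + b5) / T
         + (2 * Z T * ((Z T - 1) * W T + b3)) / T),
      is_derive T 1 Y
        (- ((2 * X T * Y T ^+ 2) / T) + Y T ^+ 2 / T - 2 * X T * Y T
         + (1 + (2 * b2 + 2 * b3 + b5 + b4) / T) * Y T - b1),
      is_derive T 1 Z
        ((2 * Z T ^+ 2 * W T) / T + Z T ^+ 2 - (2 * Z T * W T) / T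
         - (1 + (b5 + b4) / T) * Z T + b5 / T
         + (2 * Y T * Z T * (Z T - 1)) / T)
    & is_derive T 1 W
        (- ((2 * Z T * W T ^+ 2) / T) + W T ^+ 2 / T - 2 * Z T * W T
         + (1 + (b5 + b4) / T) * W T - b3
         - (2 * Y T * (- W T + 2 * Z T * W T + b3)) / T)].

(* 'D_1 is total; the partial derivatives of H are required to exist. *)
Definition hamiltonian_system (H : K -> K -> K -> K -> K -> K)
    D X Y Z W : Prop :=
  forall T, D T ->
  let HX := fun q => H q (Y T) (Z T) (W T) T in
  let HY := fun p => H (X T) p (Z T) (W T) T in
  let HZ := fun q => H (X T) (Y T) q (W T) T in
  let HW := fun p => H (X T) (Y T) (Z T) p T in
  [/\ derivable HX (X T) 1, derivable HY (Y T) 1,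
      derivable HZ (Z T) 1 & derivable HW (W T) 1] /\
  [/\ is_derive T 1 X ('D_1 HY (Y T)),
      is_derive T 1 Y (- 'D_1 HX (X T)),
      is_derive T 1 Z ('D_1 HW (W T))
    & is_derive T 1 W (- 'D_1 HZ (Z T))].

Definition H_A3 (q p T b1 b2 b3 : K) : K :=
  (p * (p + T) * q * (q - 1) + b2 * q * T - b3 * q * p - b1 * p * (q - 1)) / T.

Definition H_D5 (b1 b2 b3 b4 b5 : K) (X Y Z W T : K) : K :=
  H_A3 X Y T (b2 + b5) b1 (b2 + 2 * b3 + b4)
  + H_A3 Z W T b5 b3 b4
  + (2 * Y * Z * ((Z - 1) * W + b3)) / T.

(* X, Y, Z, W are functions of T = - t. *)
Definition change_of_variables (a2 a4 : K) D x y z w X Y Z W : Prop :=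
  forall t, D t ->
  [/\ X (- t) = 1 / z t,
      Y (- t) = - z t * (z t * w t + a4),
      Z (- t) = 1 / x t
    & W (- t) = - x t * (x t * y t + a2)].

End Systems.

(* Main.v *)
(** Each of the pairs [(z, w)] and [(x, y)] undergoes the same canonical map
    [(q, p) |-> (1 / q, - q (q p + a))], which is an involution, as is
    [t |-> - t].  So a single computation of derivatives transports solutions
    in both directions, and what remains is a rational identity in the values
    of the unknowns.  The Hamiltonian is a quadratic polynomial in each of the
    four canonical variables separately, whence its partial derivatives. *)

Require Import Defs.
From HB Require Import structures.
From mathcomp Require Import all_boot all_order all_algebra.
From mathcomp Require Import all_classical all_reals all_analysis.
From mathcomp Require Import ring.
Import Order.TTheory GRing.Theory Num.Theory.
Import numFieldNormedType.Exports.

Local Open Scope classical_set_scope.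
Local Open Scope ring_scope.

(** The difference quotient of [f \o -%R] at [t] with increment [h] is the opposite of that of [f]
    at [- t] with increment [- h], and [h |-> - h] preserves the punctured neighborhoods of 0. *)
Lemma is_derive_comp_opp {K : numFieldType} (f : K -> K) (t df : K) :
  is_derive (- t) 1 f df -> is_derive t 1 (f \o -%R) (- df).
Proof.
move=> [f_t <-].
have quotE h : h^-1 *: ((f \o -%R \o shift t) (h *: 1) - f (- t)) =
    - ((- h)^-1 *: ((f \o shift (- t)) (- h *: 1) - f (- t))).
  by rewrite /= opprD scaleNr invrN scaleNr opprK.
have opp0 : -%R @ (0 : K)^' --> (0 : K)^'.
  move=> A [e /= e0 eA]; exists e => //= h /= he h0; apply: eA => /=.
    by rewrite sub0r opprK -normrN -sub0r.
  by rewrite oppr_eq0.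
have lim : h^-1 *: ((f \o -%R \o shift t) (h *: 1) - f (- t)) @[h --> 0^']
    --> - 'D_1 f (- t).
  under eq_fun do rewrite quotE.
  apply: cvgN.
  apply: (cvg_comp -%R
    (fun h => h^-1 *: ((f \o shift (- t)) (h *: 1) - f (- t))) opp0 f_t).
apply: DeriveDef; last exact: cvg_lim lim.
by apply/cvg_ex; eexists; exact: lim.
Qed.

Lemma is_derive_inv {K : numFieldType} (f : K -> K) (t df : K) :
  f t != 0 -> is_derive t 1 f df ->
  is_derive t 1 (fun s => (f s)^-1) (- (df / f t ^+ 2)).
Proof.
move=> ft0 [f_t <-]; apply: DeriveDef; first exact: derivableV.
by rewrite deriveV// /GRing.scale/= mulNr mulrC.
Qed.

(** Reduces a partial derivative of the Hamiltonian to two [field] identities: only the two upper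
    coefficients have to be supplied, the constant term being [f 0]. *)
Lemma is_derive_quadratic {K : numFieldType} (f : K -> K) (a b u df : K) :
  (forall v, f v = a * v ^+ 2 + b * v + f 0) -> df = 2 * a * u + b ->
  is_derive u 1 f df.
Proof.
move=> /funext fE ->; rewrite fE.
have did := is_derive_id u (1 : K).
have := is_deriveD (is_deriveD (is_deriveZ a (is_deriveX 2 did))
  (is_deriveZ b did)) (is_derive_cst (f 0) u 1).
by move/is_derive_eq; apply; rewrite /GRing.scale/=; ring.
Qed.

Definition inverted {K : numFieldType} (a t : K) (q p Q P : K -> K) : Prop :=
  [/\ q t != 0, Q (- t) = (q t)^-1 & P (- t) = - q t * (q t * p t + a)].

(** From [Q = 1 / q] and [P = - q (q p + a)] one gets [Q P + a = - q p], hence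
    [- Q (Q P + a) = p]. *)
Lemma inverted_sym {K : numFieldType} (a t : K) (q p Q P : K -> K) :
  inverted a t q p Q P -> inverted a (- t) Q P q p.
Proof.
move=> [q0 Qt Pt]; rewrite /inverted opprK Qt Pt invr_eq0 invrK.
by split=> //; field.
Qed.

Lemma near_inverted_sym {K : numFieldType} (a t : K) (q p Q P : K -> K) :
  (\forall s \near t, inverted a s q p Q P) ->
  \forall s \near - t, inverted a s Q P q p.
Proof.
move=> qp; apply/nearN; apply: filterS qp => s; exact: inverted_sym.
Qed.

(** The relation is assumed near [t], since a pointwise one says nothing about derivatives. The sign
    produced by time reversal cancels the minus signs of [(1 / q)' = - q' / q ^+ 2] and of
    [P = - q (q p + a)]. *)
Lemma is_derive_inverted {K : numFieldType} (a t dq dp : K)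
    (q p Q P : K -> K) :
  (\forall s \near t, inverted a s q p Q P) ->
  is_derive t 1 q dq -> is_derive t 1 p dp ->
  is_derive (- t) 1 Q (dq / q t ^+ 2) /\
  is_derive (- t) 1 P (dq * (q t * p t + a) + q t * (dq * p t + q t * dp)).
Proof.
move=> qp q_t p_t; have [q0 _ _] := nbhs_singleton qp.
split.
- rewrite -[_ / _]opprK.
  apply: near_eq_is_derive (_ : is_derive (- t) 1 ((fun s => (q s)^-1) \o -%R) _).
    by apply/nearN; apply: filterS qp => s [_ /= -> _]; rewrite opprK.
  by apply: is_derive_comp_opp; rewrite opprK; exact: is_derive_inv.
- apply: near_eq_is_derive
    (_ : is_derive (- t) 1 ((- q * (q * p + cst a)) \o -%R) _).
    by apply/nearN; apply: filterS qp => s [_ _ /= ->]; rewrite opprK.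
  rewrite -[X in is_derive _ _ _ X]opprK.
  apply: is_derive_comp_opp; rewrite opprK.
  apply: is_derive_eq; rewrite /GRing.scale/=.
  have -> : (- q) t = - q t by [].
  have -> : (q * p + cst a) t = q t * p t + a by [].
  by ring.
Qed.

Section PartialDerivatives.
Variables (K : numFieldType) (b1 b2 b3 b4 b5 X Y Z W T : K).
Hypothesis T0 : T != 0.
Let H := H_D5 b1 b2 b3 b4 b5.

(** The double opposite keeps the right-hand side of [D5_system] for [Y] verbatim, so that
    Hamilton's equations will match it after cancelling signs; likewise for the derivative in
    [Z]. *)
Lemma is_derive_H_D5_X :
  is_derive X 1 (fun q => H q Y Z W T)
    (- (- ((2 * X * Y ^+ 2) / T) + Y ^+ 2 / T - 2 * X * Y
        + (1 + (2 * b2 + 2 * b3 + b5 + b4) / T) * Y - b1)).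
Proof.
apply: (is_derive_quadratic _ (Y * (Y + T) / T)
    ((b1 * T - Y * (Y + T) - (2 * b2 + 2 * b3 + b4 + b5) * Y) / T)) => [v|]; last by field.
by rewrite /H /H_D5 /H_A3; field.
Qed.

Lemma is_derive_H_D5_Y :
  is_derive Y 1 (fun p => H X p Z W T)
    ((2 * X ^+ 2 * Y) / T + X ^+ 2 - (2 * X * Y) / T
     - (1 + (2 * b2 + 2 * b3 + b5 + b4) / T) * X + (b2 + b5) / T
     + (2 * Z * ((Z - 1) * W + b3)) / T).
Proof.
apply: (is_derive_quadratic _ (X * (X - 1) / T)
    ((T * X * (X - 1) - (b2 + 2 * b3 + b4) * X - (b2 + b5) * (X - 1)
      + 2 * Z * ((Z - 1) * W + b3)) / T)) => [v|]; last by field.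
by rewrite /H /H_D5 /H_A3; field.
Qed.

Lemma is_derive_H_D5_Z :
  is_derive Z 1 (fun q => H X Y q W T)
    (- (- ((2 * Z * W ^+ 2) / T) + W ^+ 2 / T - 2 * Z * W
        + (1 + (b5 + b4) / T) * W - b3
        - (2 * Y * (- W + 2 * Z * W + b3)) / T)).
Proof.
(* The coupling term of [H_D5] is itself quadratic in [Z], whence the extra [2 * Y] in the leading
   coefficient; in each of the other variables its degree is at most one. *)
apply: (is_derive_quadratic _ (W * (W + T + 2 * Y) / T)
    ((b3 * T - W * (W + T) - (b4 + b5) * W + 2 * Y * (b3 - W)) / T)) => [v|]; last by field.
by rewrite /H /H_D5 /H_A3; field.
Qed.

Lemma is_derive_H_D5_W :
  is_derive W 1 (fun p => H X Y Z p T)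
    ((2 * Z ^+ 2 * W) / T + Z ^+ 2 - (2 * Z * W) / T
     - (1 + (b5 + b4) / T) * Z + b5 / T
     + (2 * Y * Z * (Z - 1)) / T).
Proof.
apply: (is_derive_quadratic _ (Z * (Z - 1) / T)
    ((T * Z * (Z - 1) - b4 * Z - b5 * (Z - 1) + 2 * Y * Z * (Z - 1)) / T)) => [v|]; last by field.
by rewrite /H /H_D5 /H_A3; field.
Qed.

End PartialDerivatives.

Lemma hamiltonian_system_D5 {K : numFieldType} (b1 b2 b3 b4 b5 : K)
    (V : set K) (X Y Z W : K -> K) :
  (forall T, V T -> T != 0) ->
  hamiltonian_system (H_D5 b1 b2 b3 b4 b5) V X Y Z W <->
  D5_system b1 b2 b3 b4 b5 V X Y Z W.
Proof.
move=> V0; have dX T (VT : V T) :=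
  is_derive_H_D5_X _ b1 b2 b3 b4 b5 (X T) (Y T) (Z T) (W T) T (V0 T VT).
have dY T (VT : V T) :=
  is_derive_H_D5_Y _ b1 b2 b3 b4 b5 (X T) (Y T) (Z T) (W T) T (V0 T VT).
have dZ T (VT : V T) :=
  is_derive_H_D5_Z _ b1 b2 b3 b4 b5 (X T) (Y T) (Z T) (W T) T (V0 T VT).
have dW T (VT : V T) :=
  is_derive_H_D5_W _ b1 b2 b3 b4 b5 (X T) (Y T) (Z T) (W T) T (V0 T VT).
split=> sys T VT; move: (dX T VT) (dY T VT) (dZ T VT) (dW T VT) (sys T VT);
  move=> [HX dHX] [HY dHY] [HZ dHZ] [HW dHW].
- rewrite /= dHX dHY dHZ dHW !opprK => -[_ [X_T Y_T Z_T W_T]].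
  split; [exact: X_T|exact: Y_T|exact: Z_T|exact: W_T].
- move=> [X_T Y_T Z_T W_T]; rewrite /= dHX dHY dHZ dHW !opprK.
  split; split; [exact: HX|exact: HY|exact: HZ|exact: HW
                |exact: X_T|exact: Y_T|exact: Z_T|exact: W_T].
Qed.

Lemma xyzw_D5_system {K : numFieldType} (a0 a1 a2 a3 a4 a5 : K)
    (U : set K) (x y z w X Y Z W : K -> K) :
  a0 + a1 + 2 * a2 + 2 * a3 + 2 * a4 + 2 * a5 = 1 ->
  open U ->
  (forall t, U t -> [/\ t != 0, x t != 0 & z t != 0]) ->
  change_of_variables a2 a4 U x y z w X Y Z W ->
  xyzw_system a1 a2 a3 a4 a5 U x y z w <->
  D5_system a4 a3 a2 a0 a1 [set - t | t in U] X Y Z W.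
Proof.
move=> ha openU U0 cov.
(* One system involves [a5] and the other [a0]; the normalization trades one for the other, and the
   rational identities below hold only modulo it. *)
have a0E : a0 = 1 - a1 - 2 * a2 - 2 * a3 - 2 * a4 - 2 * a5.
  by rewrite -[X in X - a1]ha; ring.
(* Openness of [U] upgrades the pointwise change of variables to one valid near each point. *)
have inv t : U t -> (\forall s \near t, inverted a4 s z w X Y) /\
                    (\forall s \near t, inverted a2 s x y Z W).
  move=> Ut; split; apply: filterS (open_nbhs_nbhs (conj openU Ut)) => s Us;
    by have [s0 xs zs] := U0 s Us; have [Xs Ys Zs Ws] := cov s Us; split;
       rewrite // (Xs, Zs) div1r.
split=> [sys _ [t Ut <-]|sys t Ut].
- have [x_t y_t z_t w_t] := sys t Ut.
  have [invz invx] := inv t Ut; have [t0 xt0 zt0] := U0 t Ut.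
  have [Xt Yt Zt Wt] := cov t Ut.
  have [X_t Y_t] := is_derive_inverted _ _ _ _ _ _ _ _ invz z_t w_t.
  have [Z_t W_t] := is_derive_inverted _ _ _ _ _ _ _ _ invx x_t y_t.
  split.
  + by apply: is_derive_eq X_t _; rewrite Xt Yt Zt Wt a0E; field;
       rewrite t0 xt0 zt0.
  + by apply: is_derive_eq Y_t _; rewrite Xt Yt a0E; field; rewrite t0 zt0.
  + by apply: is_derive_eq Z_t _; rewrite Yt Zt Wt a0E; field; rewrite t0 xt0.
  + by apply: is_derive_eq W_t _; rewrite Yt Zt Wt a0E; field; rewrite t0 xt0.
(* Conversely, the same derivative formulas are applied at [- t] with the roles of old and new
   variables exchanged; [- - t] then collapses to [t]. *)
- have [invz invx] := inv t Ut; have [t0 xt0 zt0] := U0 t Ut.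
  have [X_t Y_t Z_t W_t] := sys (- t) (imageP _ Ut).
  have [Xt Yt Zt Wt] := cov t Ut.
  have := is_derive_inverted _ _ _ _ _ _ _ _
    (near_inverted_sym _ _ _ _ _ _ invz) X_t Y_t.
  have := is_derive_inverted _ _ _ _ _ _ _ _
    (near_inverted_sym _ _ _ _ _ _ invx) Z_t W_t.
  rewrite opprK => -[x_t y_t] [z_t w_t].
  split.
  + by apply: is_derive_eq x_t _; rewrite Yt Zt Wt a0E; field; rewrite t0 xt0.
  + by apply: is_derive_eq y_t _; rewrite Yt Zt Wt a0E; field; rewrite t0 xt0.
  + by apply: is_derive_eq z_t _; rewrite Xt Yt Zt Wt a0E; field;
       rewrite t0 xt0 zt0.
  + by apply: is_derive_eq w_t _; rewrite Xt Yt Zt Wt a0E; field;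
       rewrite t0 xt0 zt0.
Qed.

Theorem theorem5p3 (K : numFieldType) (a0 a1 a2 a3 a4 a5 : K)
    (b0 b1 b2 b3 b4 b5 : K)
    (ha : a0 + a1 + 2 * a2 + 2 * a3 + 2 * a4 + 2 * a5 = 1)
    (hb0 : b0 = a4 + 2 * a5) (hb1 : b1 = a4) (hb2 : b2 = a3)
    (hb3 : b3 = a2) (hb4 : b4 = a0) (hb5 : b5 = a1) :
  b0 + b1 + 2 * b2 + 2 * b3 + b4 + b5 = 1 /\
  (forall (U : set K) (x y z w X Y Z W : K -> K),
     open U ->
     (forall t, U t -> [/\ t != 0, x t != 0 & z t != 0]) ->
     change_of_variables a2 a4 U x y z w X Y Z W ->
     let V := [set - t | t in U] in
     (xyzw_system a1 a2 a3 a4 a5 U x y z w <->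
        hamiltonian_system (H_D5 b1 b2 b3 b4 b5) V X Y Z W) /\
     (xyzw_system a1 a2 a3 a4 a5 U x y z w <->
        D5_system b1 b2 b3 b4 b5 V X Y Z W)) /\
  (forall (V : set K) (X Y Z W : K -> K),
     (forall T, V T -> T != 0) ->
     (hamiltonian_system (H_D5 b1 b2 b3 b4 b5) V X Y Z W <->
        D5_system b1 b2 b3 b4 b5 V X Y Z W)).
Proof.
subst b0 b1 b2 b3 b4 b5; split; first by rewrite -[RHS]ha; ring.
split=> [U x y z w X Y Z W openU U0 cov V|]; last first.
  by move=> V X Y Z W; exact: hamiltonian_system_D5.
have V0 T : V T -> T != 0.
  by move=> [t /U0[t0 _ _] <-]; rewrite oppr_eq0.
have D5 : xyzw_system a1 a2 a3 a4 a5 U x y z w <->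
    D5_system a4 a3 a2 a0 a1 V X Y Z W by exact: xyzw_D5_system.
by split=> //; apply: (iff_trans D5); apply: iff_sym;
   exact: hamiltonian_system_D5.
Qed.
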